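(* Let $X\subseteq\mathbb{R}^n$ and $Y\subseteq\mathbb{R}^m$ be nonempty, closed and convex, let $O_X\supseteq X$ be an open subset of $\mathbb{R}^n$, and let $g:\mathbb{R}^n\times\mathbb{R}^m\to\mathbb{R}$ be Lipschitz continuous with $g(x,\cdot)$ convex for each $x\in O_X$. Let $\{g_\mu:\mu>0\}$ be a family of smooth approximations of $g$ over $\mathbb{R}^n\times\mathbb{R}^m$. Suppose that: (1) for every open set $\Omega$ with $\mathrm{cl}(\Omega)\subseteq O_X$ and every $\mu>0$, $g_\mu$ is bounded below on $\mathrm{cl}(\Omega)\times Y$; (2) $g_\mu(x,\cdot)$ is convex for every $x\in O_X$ and $\mu>0$; (3) $(x,y,\mu)\mapsto g_\mu(x,y)$ is continuous on $\mathbb{R}^n\times\mathbb{R}^m\times(0,\infty)$; (4) $g$ is level-bounded in $y$ locally uniformly in $x$; (5) for every open set $\Omega$ with $\mathrm{cl}(\Omega)\subseteq O_X$, $g_\mu\to g$ uniformly on $\mathrm{cl}(\Omega)\times Y$ as $\mu\searrow0$. Define $v(x)=\min_{y\in Y}g(x,y)$ and, for $\mu>0$, $$v_\mu^{\rm quad}(x)=\min_{y\in Y}\Big(g_\mu(x,y)+\tfrac{\mu}{2}\|y\|^2\Big).$$ Then $\{v_\mu^{\rm quad}:\mu>0\}$ is a family of smooth approximations of $v$ over $O_X$.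
   Context: Smooth approximations: for an open set $O\subseteq\mathbb{R}^d$ and a continuous function $\phi:O\to\mathbb{R}$, $\{\phi_\mu:\mu>0\}$ is a family of smooth approximations of $\phi$ over $O$ if each $\phi_\mu:O\to\mathbb{R}$ is continuously differentiable and for all $\bar z\in O$, $\lim_{z\to\bar z,\ \mu\searrow0}\phi_\mu(z)=\phi(\bar z)$. Level-boundedness: $g$ is level-bounded in $y$ locally uniformly in $x$ if for each $x'\in\mathbb{R}^n$ and $M\in\mathbb{R}$ there is an open ball $B$ around $x'$ such that $\{(x,y):x\in B,\ g(x,y)\le M\}$ is bounded. $\mathrm{cl}$ denotes closure and $\|\cdot\|$ the Euclidean norm. *)

(* Defs.v *)
(* R^n is 'rV[R]_n over a realType R, and R^n x R^m is the product type. *)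
From mathcomp Require Import all_boot all_order all_algebra.
From mathcomp Require Import all_classical all_reals all_analysis.
Import Order.TTheory GRing.Theory Num.Theory.
Import numFieldNormedType.Exports.

Set Implicit Arguments.
Unset Strict Implicit.
Unset Printing Implicit Defensive.

Local Open Scope classical_set_scope.
Local Open Scope ring_scope.

(* The library norm on 'rV[R]_n is the sup norm. *)
Definition enorm (R : realType) (n : nat) (x : 'rV[R]_n) : R :=
  Num.sqrt (\sum_(i < n) x ord0 i ^+ 2).

Definition enorm_pair (R : realType) (n m : nat) (p : 'rV[R]_n * 'rV[R]_m) : R :=
  Num.sqrt (enorm p.1 ^+ 2 + enorm p.2 ^+ 2).

Definition eball (R : realType) (n : nat) (x : 'rV[R]_n) (r : R) : set 'rV[R]_n :=
  [set z | enorm (z - x) < r].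

Definition elipschitz (R : realType) (n m : nat)
    (g : 'rV[R]_n * 'rV[R]_m -> R) : Prop :=
  exists L : R, forall p q, `|g p - g q| <= L * enorm_pair (p - q).

(* Meant for an open O, where neither differentiability at a point of O nor the
   continuity of the derivative depends on the values of f outside O. The second
   clause is continuity of z |-> 'd f z for the operator norm; in finite
   dimension this does not depend on the choice of the norm on V. *)
Definition C1_on (R : realType) (V : normedModType R) (O : set V) (f : V -> R) : Prop :=
  forall z, O z ->
    differentiable f z /\
    forall e : R, 0 < e ->
      \forall w \near z, forall u : V, `|'d f w u - 'd f z u| <= e * `|u|.

(* Functions on O are represented by total functions, and families indexed by
   mu > 0 by families indexed by R; only values on O and at mu > 0 matter. *)
Definition smooth_approximations (R : realType) (V : normedModType R)
    (O : set V) (phi : V -> R) (phi_ : R -> V -> R) : Prop :=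
  [/\ {within O, continuous phi},
      forall mu : R, 0 < mu -> C1_on O (phi_ mu)
    & forall zbar, O zbar ->
        phi_ p.2 p.1 @[p --> filter_prod (nbhs zbar) (0 : R)^'+] --> phi zbar].

Definition level_bounded_locally_uniformly (R : realType) (n m : nat)
    (g : 'rV[R]_n * 'rV[R]_m -> R) : Prop :=
  forall (x' : 'rV[R]_n) (M : R), exists2 r : R, 0 < r &
    bounded_set [set p : 'rV[R]_n * 'rV[R]_m | eball x' r p.1 /\ g p <= M].

Definition attains_min (R : realType) (T : Type) (Y : set T) (f : T -> R) : Prop :=
  exists2 y, Y y & forall y', Y y' -> f y <= f y'.

(* Equals the minimum of f over Y whenever attains_min Y f holds. *)
Definition min_value (R : realType) (T : Type) (Y : set T) (f : T -> R) : R :=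
  inf (f @` Y).

Definition quad_reg (R : realType) (n m : nat)
    (g_ : R -> 'rV[R]_n * 'rV[R]_m -> R) (mu : R)
    (x : 'rV[R]_n) (y : 'rV[R]_m) : R :=
  g_ mu (x, y) + mu / 2 * enorm y ^+ 2.

(* Main.v *)
(* For fixed mu > 0 the objective g_mu(x, .) + mu/2 |.|^2 is strongly convex, so its
   minimizer over Y is unique.  Since g_mu is bounded below on Y uniformly for x in a
   small ball, the quadratic term keeps the minimizers in a compact set, and uniqueness
   makes them depend continuously on x.  Danskin's argument then gives the value
   function the gradient D_x g_mu(x, y(x)), which is continuous.  Convergence to v
   compares values at the minimizers of either problem, using the uniform convergence
   of g_mu and the Lipschitz continuity of g in x. *)
Require Import Defs.
From mathcomp Require Import all_boot all_order all_algebra.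
From mathcomp Require Import all_classical all_reals all_analysis.
From mathcomp Require Import lra ring.
Import Order.TTheory GRing.Theory Num.Theory.
Import numFieldNormedType.Exports.
Local Open Scope classical_set_scope.
Local Open Scope ring_scope.

(** * Slices of functions on a product, attained minima, and continuity of minimizers *)

Lemma cvg_pair_cstr {U V : topologicalType} (x : U) (y : V) :
  (z, y) @[z --> x] --> (x, y).
Proof. by apply: cvg_pair; [exact: cvg_id | exact: cvg_cst]. Qed.

Lemma cvg_slicel {U V W : topologicalType} (f : U * V -> W) x y :
  {for (x, y), continuous f} -> f (z, y) @[z --> x] --> f (x, y).
Proof. by move=> cf A /cf /(cvg_pair_cstr x y). Qed.

Lemma attains_minP {R : realType} {T : Type} (Y : set T) (f : T -> R) :
  attains_min Y f ->
  exists y, [/\ Y y, f y = min_value Y f & forall y', Y y' -> f y <= f y'].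
Proof.
move=> [y Yy ymin]; exists y; split=> //; apply/esym/eqP.
rewrite /min_value eq_le; apply/andP; split.
  by apply: ge_inf; [exists (f y) => _ [z Yz <-]; exact: ymin | exists y].
by apply: lb_le_inf; [exists (f y), y | move=> _ [z Yz <-]; exact: ymin].
Qed.

Lemma min_value_le {R : realType} {T : Type} (Y : set T) (f : T -> R) y :
  attains_min Y f -> Y y -> min_value Y f <= f y.
Proof. by move=> /attains_minP[z [_ <- +]] => /[apply]. Qed.

(** The sublevel set through [y0] is closed and bounded, hence compact, and a minimizer on it beats
    every point of [Y] outside it, where [f] exceeds [f y0]. *)
Lemma attains_min_bounded_sublevel {R : realType} {m : nat}
    (Y : set 'rV[R]_m) (f : 'rV[R]_m -> R) y0 :
  closed Y -> Y y0 -> continuous f ->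
  bounded_set [set y | Y y /\ f y <= f y0] -> attains_min Y f.
Proof.
move=> clY Yy0 cf bS; set S := [set y | Y y /\ f y <= f y0] in bS.
have clS : closed S.
  have -> : S = Y `&` f @^-1` [set x | x <= f y0] by [].
  by apply: closedI => //; apply: preimage_closed (@closed_le _ _) => y _; exact: cf.
have S0 : S !=set0 by exists y0.
have [c cS cmin] := compact_EVT_min S0 (bounded_closed_compact bS clS)
  (continuous_subspaceT cf).
move: cS; rewrite inE => -[Yc cy0]; exists c => // y Yy.
have [yy0|/ltW yy0] := leP (f y) (f y0); last exact: le_trans cy0 yy0.
by apply: cmin; rewrite inE.
Qed.

(* Every point of K outside a neighbourhood W of the minimizer at x0 has a larger
   value than that minimizer, uniformly near x0 by compactness; so the minimizers
   near x0 lie in W. *)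
Lemma minimizer_cvg {R : realType} {T : topologicalType} {V : topologicalType}
    (K : set V) (F : T * V -> R) (ybar : T -> V) (x0 : T) :
  compact K -> (forall y, {for (x0, y), continuous F}) ->
  (forall y, K y -> F (x0, y) <= F (x0, ybar x0) -> y = ybar x0) ->
  (\forall x \near x0, K (ybar x) /\ F (x, ybar x) <= F (x, ybar x0)) ->
  ybar x @[x --> x0] --> ybar x0.
Proof.
move=> cK cF uniq nK W; rewrite nbhsE => -[W' [oW' W'y] W'W].
have cKW : compact (K `&` ~` W') by apply: compact_closedI => //; exact: open_closedC.
have /= := proj1 (compact_near_coveringP _) cKW T (nbhs x0)
  (fun x y => F (x, ybar x0) < F (x, y)) _.
have H : forall y, (K `&` ~` W') y ->
    \forall y' \near y & x \near x0, F (x, ybar x0) < F (x, y').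
  move=> y [Ky nWy].
  have lt : F (x0, ybar x0) < F (x0, y).
    by rewrite ltNge; apply/negP => /(uniq _ Ky) e; rewrite e in nWy.
  (* The midpoint of the two values separates them: [F (x, ybar x0)] stays below [c] near [x0],
     while [F] stays above [c] near [(x0, y)]. *)
  pose c := (F (x0, ybar x0) + F (x0, y)) / 2.
  have n1 : \forall x \near x0, F (x, ybar x0) < c.
    by apply: (cvgr_lt _ (cvg_slicel F x0 _ (cF _))); rewrite /c; lra.
  have n2 : \forall p \near (x0, y), c < F p.
    by apply: (cvgr_gt _ (cF y)); rewrite /c; lra.
  move: n2 => [[A B] /= [nA nB] AB].
  exists (B, A `&` [set x | F (x, ybar x0) < c]) => /=.
    by split=> //; exact: filterI.
  by move=> -[y' x] /= [By' [Ax ltc]]; apply: lt_trans ltc (AB (x, y') _).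
move=> /(_ _ H) nKW; change (\forall x \near x0, W (ybar x)).
near=> x; apply: W'W; apply: contrapT => nW.
have [Kx le] : K (ybar x) /\ F (x, ybar x) <= F (x, ybar x0) by near: x.
have : F (x, ybar x0) < F (x, ybar x).
  have KW : K `&` ~` W' `<=` fun y => F (x, ybar x0) < F (x, y) by near: x.
  exact: KW.
by rewrite ltNge le.
Unshelve. all: by end_near. Qed.

(** * The Euclidean norm and its comparison with the sup norm *)

Section EuclideanNorm.
Context {R : realType} {m : nat}.
Implicit Types x y z : 'rV[R]_m.

Lemma enorm_ge0 x : 0 <= enorm x.
Proof. exact: sqrtr_ge0. Qed.

Lemma enorm_sqr x : enorm x ^+ 2 = \sum_(i < m) x ord0 i ^+ 2.
Proof. by rewrite sqr_sqrtr// sumr_ge0// => i _; exact: sqr_ge0. Qed.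

Lemma enorm_sqr_continuous : continuous (fun x => enorm x ^+ 2).
Proof.
have -> : (fun x => enorm x ^+ 2) = (fun x => \sum_(i < m) x ord0 i ^+ 2).
  by apply/funext => x; exact: enorm_sqr.
move=> x; apply: (@cvg_big _ _ _ _ _ (@add_continuous R) _ (nbhs x)) => i _.
apply: (@continuous_comp _ _ _ (fun y : 'rV[R]_m => y ord0 i) (fun r => r ^+ 2)).
  exact: coord_continuous.
exact: exprn_continuous.
Qed.

Lemma mx_norm_coord x i : `|x ord0 i| <= `|x|.
Proof.
by rewrite [leRHS]/Num.norm /= mx_normrE; apply/bigmax_geP; right => /=; exists (ord0, i).
Qed.

Lemma mx_norm_le x (c : R) : 0 <= c -> (forall i, `|x ord0 i| <= c) -> `|x| <= c.
Proof.
move=> c0 xc; rewrite [leLHS]/Num.norm /= mx_normrE; apply/bigmax_leP; split => //.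
by move=> [i j] _ /=; rewrite ord1.
Qed.

Lemma norm_le_enorm x : `|x| <= enorm x.
Proof.
apply: mx_norm_le => [|i]; first exact: enorm_ge0.
rewrite -ler_sqr ?nnegrE ?enorm_ge0// enorm_sqr (bigD1 i)//= real_normK ?num_real//.
by rewrite lerDl sumr_ge0// => j _; exact: sqr_ge0.
Qed.

Lemma enorm_le_norm x : enorm x <= Num.sqrt m%:R * `|x|.
Proof.
rewrite -ler_sqr ?nnegrE ?enorm_ge0 ?mulr_ge0 ?sqrtr_ge0// enorm_sqr exprMn.
rewrite sqr_sqrtr ?ler0n//.
have -> : m%:R * `|x| ^+ 2 = \sum_(i < m) `|x| ^+ 2.
  by rewrite sumr_const card_ord mulr_natl.
apply: ler_sum => i _; rewrite -(@real_normK _ (x ord0 i)) ?num_real//.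
by rewrite ler_sqr ?nnegrE ?normr_ge0// mx_norm_coord.
Qed.

Lemma enorm_sqr_le0 x : enorm x ^+ 2 <= 0 -> x = 0.
Proof.
rewrite exprn_even_le0//= => /eqP x0; apply/eqP; rewrite -normr_le0 -x0.
exact: norm_le_enorm.
Qed.

(** The source of strong convexity: the last term is the strict gain of the squared norm at a
    midpoint. *)
Lemma enorm_parallelogram y z :
  enorm (2^-1 *: y + 2^-1 *: z) ^+ 2 =
  (enorm y ^+ 2 + enorm z ^+ 2) / 2 - enorm (y - z) ^+ 2 / 4.
Proof.
rewrite !enorm_sqr -big_split/= !mulr_suml -sumrB; apply: eq_bigr => i _.
by rewrite !mxE; field.
Qed.

End EuclideanNorm.

(** * Convexity at midpoints *)

Lemma convex_set_mid {R : realType} {V : lmodType R} (A : set V) y z :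
  convex_set A -> A y -> A z -> A (2^-1 *: y + 2^-1 *: z).
Proof.
have h0 : 0 <= (2^-1 : R) by lra. have h1 : (2^-1 : R) <= 1 by lra.
move=> /(_ y z (Itv01 h0 h1)) + Ay Az; rewrite !inE => /(_ Ay Az).
rewrite /conv/= /unstable.onem (_ : 1 - 2^-1 = 2^-1 :> R); last lra.
by [].
Qed.

Lemma convex_function_mid {R : realType} {V : lmodType R} (f : V -> R) y z :
  convex_function setT f -> f (2^-1 *: y + 2^-1 *: z) <= (f y + f z) / 2.
Proof.
have h0 : 0 <= (2^-1 : R) by lra. have h1 : (2^-1 : R) <= 1 by lra.
move=> /(_ (Itv01 h0 h1) y z (mem_set I) (mem_set I)).
rewrite [leRHS]convRE/= /conv/= /unstable.onem (_ : 1 - 2^-1 = 2^-1 :> R); last lra.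
by rewrite -mulrDr mulrC.
Qed.

(** * Mean value estimates along segments and Danskin's argument *)

Lemma is_derive_along_line {R : realType} {E : normedModType R} (f : E -> R)
    (a u : E) (t : R) :
  differentiable f (a + t *: u) ->
  is_derive t 1 (fun s : R => f (a + s *: u)) ('d f (a + t *: u) u).
Proof.
move=> df; pose l := fun s : R => a + s *: u.
have dl : is_diff t l ( *:%R^~ u).
  have -> : l = cst a + *:%R^~ u by [].
  by apply: is_diff_eq; rewrite add0r.
have dfl : is_diff t (f \o l) ('d f (l t) \o ( *:%R^~ u)).
  by apply: is_diff_comp; apply: differentiableP.
apply: DeriveDef; first by apply/derivable1_diffP; exact: ex_diff.
by rewrite deriveE ?diff_val/= ?scale1r//; exact: ex_diff.
Qed.

(** The mean value theorem for [s |-> f (a + s *: u)] on [0, 1] turns the increment into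
    ['d f (a + t *: u) u] for some [t]. *)
Lemma segment_increment_le {R : realType} {E : normedModType R} (f : E -> R)
    (a u : E) (s c : R) :
  (forall t : R, 0 <= t <= 1 -> differentiable f (a + t *: u) /\
     `|'d f (a + t *: u) u - s| <= c) ->
  `|f (a + u) - f a - s| <= c.
Proof.
move=> H.
have dl (t : R) : 0 <= t <= 1 ->
    is_derive t 1 (fun s : R => f (a + s *: u)) ('d f (a + t *: u) u).
  by move=> /H[+ _]; exact: is_derive_along_line.
have [| |t + ft] := @MVT R (fun s : R => f (a + s *: u))
    (fun t : R => 'd f (a + t *: u) u) 0 1 ltr01.
- by move=> t; rewrite in_itv/= => /andP[t0 t1]; apply: dl; rewrite !ltW.
- apply: derivable_within_continuous => t; rewrite in_itv/= => /dl td.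
  exact: ex_derive.
rewrite in_itv/= => /andP[t0 t1].
move: ft; rewrite scale1r scale0r addr0 subr0 mulr1 => ->.
have t01 : 0 <= t <= 1 by rewrite !ltW.
by have [_] := H t t01.
Qed.

Lemma prod_norm_inl {R : realType} {U V : normedModType R} (u : U) :
  `|(u, 0 : V)| = `|u|.
Proof. by rewrite (_ : `|(u, 0)| = Num.max `|u| `|0 : V|)// normr0 max_l. Qed.

Section Danskin.
Context {R : realType} {U V : normedModType R}.
Variable G : U * V -> R.
Hypothesis C1G : C1_on setT G.

Lemma diff_partial x y : differentiable (fun x => G (x, y)) x /\
  'd (fun x => G (x, y)) x = (fun u => 'd G (x, y) (u, 0)) :> (U -> R).
Proof.
have dl : is_diff x (fun x => (x, y)) (fun u : U => (u, 0 : V)).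
  exact: is_diff_pair.
have dG : is_diff (x, y) G ('d G (x, y)).
  by apply: differentiableP; have [] := C1G (x, y) I.
have dGl : is_diff x (G \o (fun x => (x, y))) ('d G (x, y) \o (fun u : U => (u, 0 : V))).
  exact: is_diff_comp.
by split; [exact: ex_diff | exact: diff_val].
Qed.

(** Continuity of ['d G] makes the first-order expansion in the first argument uniform in the second
    one near [y0]. This uniformity allows the second argument to move with [x], as a minimizer
    does. *)
Lemma partial_strict_diff x0 y0 (e : R) : 0 < e ->
  \forall p \near (x0, y0),
    `|G p - G (x0, p.2) - 'd G (x0, y0) (p.1 - x0, 0)| <= e * `|p.1 - x0|.
Proof.
move=> e0; have [_ /(_ e e0)/nbhs_ballP[r /= r0 rG]] := C1G (x0, y0) I.
apply/nbhs_ballP; exists r => // -[x y] [/= xr yr].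
(* The segment from [(x0, y)] to [(x, y)] moves in the first coordinate only and stays in the ball
   of radius [r]. *)
have {1}-> : (x, y) = (x0, y) + (x - x0, 0) by congr pair => /=; rewrite ?addr0 ?subrKC.
apply: segment_increment_le => t /andP[t0 t1]; set p := _ + _.
split; first by have [] := C1G p I.
rewrite -(prod_norm_inl (V := V) (x - x0)); apply: rG.
split => /=; last by rewrite scaler0 addr0.
move: xr; rewrite -!ball_normE/= => xr; rewrite opprD addNKr normrN normrZ distrC.
by rewrite (le_lt_trans _ xr)// ler_piMl// ger0_norm.
Qed.

(* Comparing at x both with the minimizer of x and with that of z, the increment of v
   is squeezed between two increments of G in its first argument. *)
Lemma C1_on_min (O : set U) (Y : set V) (h : V -> R) (v : U -> R) (ybar : U -> V) :
  open O ->
  (forall x, O x -> Y (ybar x) /\ v x = G (x, ybar x) + h (ybar x)) ->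
  (forall x y, O x -> Y y -> v x <= G (x, y) + h y) ->
  (forall x, O x -> ybar z @[z --> x] --> ybar x) ->
  C1_on O v.
Proof.
move=> oO vE vle cy.
have cp z : O z -> (x, ybar x) @[x --> z] --> (z, ybar z).
  by move=> Oz; apply: cvg_pair; [exact: cvg_id | exact: cy].
have nO z : O z -> \forall x \near z, O x by move=> Oz; exact: open_nbhs_nbhs.
have dv z : O z -> differentiable v z /\
    'd v z = (fun u => 'd G (z, ybar z) (u, 0)) :> (U -> R).
  move=> Oz; have [dG dGE] := diff_partial z (ybar z).
  pose A := 'd (fun x => G (x, ybar z)) z.
  have cA : continuous A by exact: diff_continuous.
  have vo : v \o shift z = cst (v z) + A +o_0 id.
    apply/eqaddoP => e e0.
    have nz : \forall x \near z, `|v x - v z - A (x - z)| <= e * `|x - z|.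
      (* The strict expansion is pulled back along two curves: [n1] with the minimizer frozen at
         [ybar z], [n2] with the moving minimizer [ybar x], which needs its continuity. *)
      have n1 := cvg_pair_cstr z (ybar z) _ (partial_strict_diff z (ybar z) e e0).
      have n2 := cp z Oz _ (partial_strict_diff z (ybar z) e e0).
      near=> x.
      have Ox : O x by near: x; exact: nO.
      have : `|G (x, ybar z) - G (z, ybar z) - A (x - z)| <= e * `|x - z|.
        by rewrite /A dGE; near: x; exact: n1.
      have : `|G (x, ybar x) - G (z, ybar x) - A (x - z)| <= e * `|x - z|.
        by rewrite /A dGE; near: x; exact: n2.
      (* Each comparison uses one and the same point, [ybar z] or [ybar x], at both [x] and [z], so
         the terms in [h] cancel. *)
      have [Yx vx] := vE x Ox; have [Yz vz] := vE z Oz.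
      move: (vle x _ Ox Yz) (vle z _ Oz Yx); rewrite !ler_norml.
      move=> + + /andP[+ _] /andP[_]; move: vx vz; lra.
    have : \forall d \near (0 : U), `|v (d + z) - v z - A d| <= e * `|d|.
      have dz : d + z @[d --> (0 : U)] --> z.
        by rewrite -[X in _ --> X]add0r; apply: cvgD; [exact: cvg_id | exact: cvg_cst].
      have : \forall d \near (0 : U),
          `|v (d + z) - v z - A (d + z - z)| <= e * `|d + z - z| by exact: (dz _ nz).
      by apply: filterS => d; rewrite addrK.
    by apply: filterS => d /=; rewrite !fctE/= opprD addrA.
  have dvE : 'd v z = A :> (U -> R) by exact: diff_unique.
  split; last by rewrite dvE.
  by apply/diff_locallyP; rewrite dvE.
move=> z Oz; split; first by have [] := dv z Oz.
move=> e e0; have [_ /(_ e e0) n] := C1G (z, ybar z) I.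
have n' := cp z Oz _ n.
near=> w => u; have [_ ->] := dv z Oz.
have Ow : O w by near: w; exact: nO.
have [_ ->] := dv w Ow.
(* Since [(u, 0)] has the norm of [u], the estimate for ['d G] along the minimizers passes to ['d v]
   with the same [e]. *)
rewrite -(prod_norm_inl (V := V) u).
suff : forall u, `|'d G (w, ybar w) u - 'd G (z, ybar z) u| <= e * `|u| by exact.
by near: w; exact: n'.
Unshelve. all: by end_near. Qed.

End Danskin.

(** * Strong convexity and coercivity of the quadratic term *)

Lemma quad_minimizer_unique {R : realType} {m : nat} (Y : set 'rV[R]_m)
    (q : 'rV[R]_m -> R) (mu : R) y z :
  0 < mu -> convex_set Y -> convex_function setT q -> Y y -> Y z ->
  (forall w, Y w -> q y + mu / 2 * enorm y ^+ 2 <= q w + mu / 2 * enorm w ^+ 2) ->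
  q z + mu / 2 * enorm z ^+ 2 <= q y + mu / 2 * enorm y ^+ 2 -> z = y.
Proof.
move=> mu0 cY cq Yy Yz ymin zy; apply/eqP; rewrite -subr_eq0; apply/eqP.
apply: enorm_sqr_le0; have := ymin _ (convex_set_mid _ _ _ cY Yz Yy).
have := convex_function_mid _ z y cq; rewrite enorm_parallelogram => qw yw.
(* The midpoint value is at most the value at [y] minus mu/8 times the squared distance, and by
   minimality of [y] it is no smaller than the value at [y]. *)
have : mu * enorm (z - y) ^+ 2 <= 0 by lra.
by rewrite pmulr_rle0.
Qed.

Lemma quad_sublevel_bound {R : realType} {m : nat} (y : 'rV[R]_m) (mu c a q : R) :
  0 < mu -> c <= q -> q + mu / 2 * enorm y ^+ 2 <= a ->
  `|y| <= 2 * (a - c) / mu + 1.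
Proof.
move=> mu0 cq qa; apply: le_trans (norm_le_enorm y) _.
set B := _ / mu; have yB : enorm y ^+ 2 <= B.
  by rewrite ler_pdivlMr//; lra.
(* The inequality t <= t^2 + 1 avoids a square root and explains the [+ 1] in the bound. *)
by have := enorm_ge0 y; move: yB; nra.
Qed.

(** * Norm bounds, localization and uniform estimates *)

Lemma bounded_set_le {R : realType} {V : normedModType R} (A : set V) (B : R) :
  (forall y, A y -> `|y| <= B) -> bounded_set A.
Proof.
move=> AB; exists B; split; first exact: num_real.
by move=> M /ltW BM y /AB /le_trans; exact.
Qed.

Lemma elipschitz_norm {R : realType} {n m : nat} (g : 'rV[R]_n * 'rV[R]_m -> R) :
  elipschitz g ->
  exists2 C, 0 <= C & forall x x' y, `|g (x, y) - g (x', y)| <= C * `|x - x'|.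
Proof.
move=> [L gL]; exists (`|L| * Num.sqrt n%:R) => [|x x' y].
  by rewrite mulr_ge0// sqrtr_ge0.
apply: le_trans (gL _ _) _; rewrite /enorm_pair/= subrr.
have -> : enorm (0 : 'rV[R]_m) ^+ 2 = 0.
  by rewrite enorm_sqr big1// => i _; rewrite mxE expr0n.
rewrite addr0 sqrtr_sqr ger0_norm ?enorm_ge0//.
apply: (@le_trans _ _ (`|L| * enorm (x - x'))).
  by rewrite ler_wpM2r ?enorm_ge0// ler_norm.
by rewrite -mulrA ler_wpM2l// enorm_le_norm.
Qed.

(** Supplies the sets [Omega] on which the lower bound and the uniform convergence are assumed.
    Halving the radius makes the closed ball fit into [O]. *)
Lemma open_nbhs_closure {R : realType} {V : normedModType R} (O : set V) x :
  open O -> O x -> exists Omega, [/\ open Omega, Omega x & closure Omega `<=` O].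
Proof.
move=> oO Ox; have /nbhs_ballP[r /= r0 rO] : nbhs x O by exact: open_nbhs_nbhs.
have r20 : 0 < r / 2 by rewrite divr_gt0.
exists (ball x (r / 2)); split; [exact: ball_open | exact: ballxx |].
rewrite closure_ballE; apply: subset_trans rO; apply: closed_ball_subset => //.
by rewrite ltr_pdivrMr// ltr_pMr// ltr1n.
Qed.

Lemma uniform_near_dist {R : realType} {T : Type} {U : choiceType} (F : set_system T)
    (A : set U) (f : T -> U -> R) (l : U -> R) (e : R) : Filter F ->
  {uniform A, f t @[t --> F] --> l} -> 0 < e ->
  \forall t \near F, forall p, A p -> `|l p - f t p| < e.
Proof.
move=> FF fl e0; apply: (fl [set h | forall p, A p -> `|l p - h p| < e]).
apply/uniform_nbhs; exists [set ab | ball ab.1 e ab.2].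
by split; [exact: entourage_ball (PosNum e0) | move=> h /=].
Qed.

Lemma near_norm_mul_lt {R : realType} {V : normedModType R} (C e : R) (x : V) :
  0 < e -> \forall z \near x, C * `|z - x| < e.
Proof.
move=> e0; have Cx : C * `|z - x| @[z --> x] --> C * `|x - x|.
  apply: cvgM; first exact: cvg_cst.
  by apply: cvg_norm; apply: cvgB; [exact: cvg_id | exact: cvg_cst].
apply: (@cvgr_lt _ _ _ _ (fun z => C * `|z - x|) _ Cx).
by rewrite subrr normr0 mulr0.
Qed.

Lemma continuous_within_lipschitz {R : realType} {V : normedModType R} (O : set V)
    (v : V -> R) (C : R) :
  open O -> (forall x z, O x -> O z -> v x - v z <= C * `|x - z|) ->
  {within O, continuous v}.
Proof.
move=> oO vC; apply: continuous_in_subspaceT => x /set_mem Ox.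
apply/cvgrPdist_le => e e0; near=> z.
have Oz : O z by near: z; exact: open_nbhs_nbhs.
have Cz : C * `|z - x| < e by near: z; exact: near_norm_mul_lt.
rewrite ler_norml; have := vC x z Ox Oz; have := vC z x Oz Ox.
by rewrite (distrC x z); lra.
Unshelve. all: by end_near. Qed.

Lemma C1_on_continuous {R : realType} {E : normedModType R} (f : E -> R) :
  C1_on setT f -> continuous f.
Proof. by move=> C1f x; apply: differentiable_continuous; have [] := C1f x I. Qed.

Lemma continuous_slicer {R : realType} {U V : normedModType R} (f : U * V -> R) x :
  continuous f -> continuous (fun y => f (x, y)).
Proof.
move=> cf y; apply: (@continuous_comp _ _ _ (fun y => (x, y)) f); last exact: cf.
by apply: cvg_pair => /=; [exact: cvg_cst | exact: cvg_id].
Qed.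

(** * Smoothness of the regularized value function for fixed [mu] *)

Section QuadraticRegularization.
Context {R : realType} {n m : nat}.
Variables (OX : set 'rV[R]_n) (Y : set 'rV[R]_m).
Variables (g_ : R -> 'rV[R]_n * 'rV[R]_m -> R) (mu : R).
Hypotheses (Y_nonempty : Y !=set0) (Y_closed : closed Y) (Y_convex : convex_set Y).
Hypotheses (OX_open : open OX) (mu_gt0 : 0 < mu) (g_C1 : C1_on setT (g_ mu)).
Hypothesis g_convex : forall x, OX x -> convex_function setT (fun y => g_ mu (x, y)).
Hypothesis g_bounded_below : forall x, OX x ->
  exists c, \forall z \near x, forall y, Y y -> c <= g_ mu (z, y).

Let F p := quad_reg g_ mu p.1 p.2.

Let F_continuous : continuous F.
Proof.
have -> : F = fun p => g_ mu p + mu / 2 * enorm p.2 ^+ 2 by apply/funext => -[].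
move=> p; apply: cvgD; first exact: C1_on_continuous.
apply: cvgM; first exact: cvg_cst.
apply: (@continuous_comp _ _ _ snd (fun y : 'rV[R]_m => enorm y ^+ 2)).
  exact: cvg_snd.
exact: enorm_sqr_continuous.
Qed.

Lemma quad_reg_attains_min x : OX x -> attains_min Y (quad_reg g_ mu x).
Proof.
move=> OXx; have [y0 Yy0] := Y_nonempty.
have [c /nbhs_singleton cg] := g_bounded_below x OXx.
apply: (attains_min_bounded_sublevel Y _ y0) => //; first exact: (continuous_slicer F).
apply: bounded_set_le => y [Yy le].
exact: (quad_sublevel_bound y mu c _ (g_ mu (x, y)) mu_gt0 (cg y Yy) le).
Qed.

Lemma quad_reg_min_C1 : C1_on OX (fun x => min_value Y (quad_reg g_ mu x)).
Proof.
have [y0 Yy0] := Y_nonempty.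
have /choice[ybar ybarP] x : exists y, OX x -> [/\ Y y,
    quad_reg g_ mu x y = min_value Y (quad_reg g_ mu x) &
    forall y', Y y' -> quad_reg g_ mu x y <= quad_reg g_ mu x y'].
  (* Outside [OX] the selection takes the default value [y0]. *)
  have [OXx|nOXx] := pselect (OX x); last by exists y0.
  by have [y yP] := attains_minP _ _ (quad_reg_attains_min x OXx); exists y.
apply: (C1_on_min (g_ mu) g_C1 OX Y (fun y => mu / 2 * enorm y ^+ 2) _ ybar) => //.
- by move=> x /ybarP[Yy <- _].
- by move=> x y OXx Yy; apply: min_value_le => //; exact: quad_reg_attains_min.
move=> x OXx; have [Yx _ xmin] := ybarP x OXx.
have [c cg] := g_bounded_below x OXx.
(* By continuity [F (z, y0) < a] for [z] near [x], so the minimizers at such [z] lie in the sublevel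
   set of [a]. With the local lower bound [c], the bound [B] then confines them to one compact set
   [K]. *)
pose a := F (x, y0) + 1; pose B := 2 * (a - c) / mu + 1.
pose K := [set y : 'rV[R]_m | Y y /\ `|y| <= B].
have cK : compact K.
  apply: bounded_closed_compact.
    by apply: (bounded_set_le _ B) => y [].
  have -> : K = Y `&` Num.norm @^-1` [set r | r <= B] by [].
  by apply: closedI => //; apply: preimage_closed (@closed_le _ _) => y _;
    exact: norm_continuous.
have nO : \forall z \near x, OX z by exact: open_nbhs_nbhs.
have na : \forall z \near x, F (z, y0) < a.
  by apply: (@cvgr_lt _ _ _ _ (fun z => F (z, y0)) _
    (cvg_slicel F x y0 (F_continuous (x, y0)))); rewrite /a; lra.
apply: (minimizer_cvg (R := R) K F) => //.
- by move=> y; exact: F_continuous.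
- move=> y [Yy _] le.
  apply: (quad_minimizer_unique Y (fun y => g_ mu (x, y)) mu _ _ mu_gt0) => //.
  exact: g_convex.
- near=> z; have OXz : OX z by near: z.
  have [Yz _ zmin] := ybarP z OXz; split; last exact: zmin.
  have cgz : forall y, Y y -> c <= g_ mu (z, y) by near: z.
  have za : F (z, y0) < a by near: z.
  split=> //; apply: (quad_sublevel_bound (ybar z) mu c a _ mu_gt0 (cgz _ Yz)).
  exact: le_trans (zmin _ Yy0) (ltW za).
Unshelve. all: by end_near. Qed.

End QuadraticRegularization.

(** * Existence of minimizers, smoothness and joint convergence *)

Theorem theorem3p9 (R : realType) (n m : nat)
    (X : set 'rV[R]_n) (Y : set 'rV[R]_m) (OX : set 'rV[R]_n)
    (g : 'rV[R]_n * 'rV[R]_m -> R) (g_ : R -> 'rV[R]_n * 'rV[R]_m -> R)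
    (X_nonempty : X !=set0) (X_closed : closed X) (X_convex : convex_set X)
    (Y_nonempty : Y !=set0) (Y_closed : closed Y) (Y_convex : convex_set Y)
    (OX_open : open OX) (X_sub_OX : X `<=` OX)
    (g_lipschitz : elipschitz g)
    (g_convex : forall x, OX x -> convex_function setT (fun y => g (x, y)))
    (g_smoothing : smooth_approximations setT g g_)
    (g_bounded_below : forall Omega : set 'rV[R]_n,
        open Omega -> closure Omega `<=` OX ->
        forall mu : R, 0 < mu -> has_lbound (g_ mu @` (closure Omega `*` Y)))
    (g__convex : forall x (mu : R), OX x -> 0 < mu ->
        convex_function setT (fun y => g_ mu (x, y)))
    (g__continuous :
        {within [set q : ('rV[R]_n * 'rV[R]_m) * R | 0 < q.2],
          continuous (fun q : ('rV[R]_n * 'rV[R]_m) * R => g_ q.2 q.1)})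
    (g_level_bounded : level_bounded_locally_uniformly g)
    (g_uniform : forall Omega : set 'rV[R]_n,
        open Omega -> closure Omega `<=` OX ->
        {uniform closure Omega `*` Y, g_ mu @[mu --> 0^'+] --> g}) :
  [/\ forall x, OX x -> attains_min Y (fun y => g (x, y)),
      forall (mu : R) x, 0 < mu -> OX x -> attains_min Y (quad_reg g_ mu x)
    & smooth_approximations OX
        (fun x => min_value Y (fun y => g (x, y)))
        (fun mu x => min_value Y (quad_reg g_ mu x))].
Proof.
have [g_cont g_C1 _] := g_smoothing.
have {}g_cont : continuous g.
  by move=> p; have := g_cont p; rewrite /continuous_at nbhs_subspaceT.
have bb (mu : R) : 0 < mu -> forall x, OX x ->
    exists c, \forall z \near x, forall y, Y y -> c <= g_ mu (z, y).
  move=> mu0 x OXx; have [Om [oOm Omx clOm]] := open_nbhs_closure OX x OX_open OXx.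
  have [c cP] := g_bounded_below Om oOm clOm mu mu0; exists c.
  near=> z; have Omz : Om z by near: z; exact: open_nbhs_nbhs.
  move=> y Yy; apply: cP; exists (z, y) => //; split=> //.
  exact: subset_closure.
have gmin x : OX x -> attains_min Y (fun y => g (x, y)).
  move=> OXx; have [y0 Yy0] := Y_nonempty.
  apply: (attains_min_bounded_sublevel Y _ y0) => //; first exact: continuous_slicer.
  (* Level-boundedness around [x] at level [g (x, y0)] is restricted to the slice over the centre
     [x] of the ball. *)
  have [r r0 [M [Mreal MP]]] := g_level_bounded x (g (x, y0)).
  exists M; split=> // N /MP {}MP y [Yy gy].
  apply: (@le_trans _ _ `|(x, y)|); first by rewrite prod_normE/= le_max lexx orbT.
  apply: MP; split=> //=; rewrite /eball/= subrr.
  rewrite /enorm big1 ?sqrtr0// => i _; by rewrite mxE expr0n.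
have qmin (mu : R) x : 0 < mu -> OX x -> attains_min Y (quad_reg g_ mu x).
  move=> mu0; apply: quad_reg_attains_min => //; [exact: g_C1 | exact: bb].
have [C C0 gC] := elipschitz_norm g g_lipschitz.
pose v x := min_value Y (fun y => g (x, y)).
(* A minimizer at [z] competes at [x], so the Lipschitz bound of [g] in its first argument passes to
   [v]. *)
have v_lip x z : OX x -> OX z -> v x - v z <= C * `|x - z|.
  move=> OXx OXz; have [y [Yy vz _]] := attains_minP _ _ (gmin z OXz).
  have := min_value_le _ _ _ (gmin x OXx) Yy.
  have := gC x z y; rewrite ler_norml => /andP[_].
  by rewrite /v -vz; lra.
split=> //; split.
- exact: (continuous_within_lipschitz OX v C).
- move=> mu mu0; apply: quad_reg_min_C1 => //; [exact: g_C1 | | exact: bb].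
  by move=> x OXx; exact: g__convex.
move=> x OXx; have [Om [oOm Omx clOm]] := open_nbhs_closure OX x OX_open OXx.
apply/cvgrPdist_le => e e0.
have [yb [Yyb vx _]] := attains_minP _ _ (gmin x OXx).
(* One third each for moving [x] to [z], for replacing [g] by [g_ mu], and for the quadratic term at
   the fixed minimizer [yb]. *)
have e3 : 0 < e / 3 by lra.
have nC : \forall z \near x, Om z /\ C * `|z - x| < e / 3.
  by near=> z; split; near: z;
    [exact: open_nbhs_nbhs | exact: (near_norm_mul_lt C (e / 3) x e3)].
have nmu : \forall mu \near (0 : R)^'+, [/\ 0 < mu, mu / 2 * enorm yb ^+ 2 < e / 3 &
    forall p, (closure Om `*` Y) p -> `|g p - g_ mu p| < e / 3].
  near=> mu; split.
  - by near: mu; exact: nbhs_right_gt.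
  (* The added 1 keeps the divisor positive when [yb] is zero. *)
  - suff : mu * (enorm yb ^+ 2 + 1) < e / 3.
      have : 0 < mu by near: mu; exact: nbhs_right_gt.
      by have := sqr_ge0 (enorm yb); nra.
    rewrite -ltr_pdivlMr ?ltr_wpDl ?sqr_ge0//; near: mu; apply: nbhs_right_lt.
    by rewrite divr_gt0// ltr_wpDl ?sqr_ge0.
  - by near: mu; exact: (uniform_near_dist _ _ _ _ _ _ (g_uniform Om oOm clOm)).
exists ([set z | Om z /\ C * `|z - x| < e / 3], [set mu | [/\ 0 < mu,
  mu / 2 * enorm yb ^+ 2 < e / 3 &
  forall p, (closure Om `*` Y) p -> `|g p - g_ mu p| < e / 3]]) => //= -[z mu] /=.
move=> [[Omz zx] [mu0 muyb gmu]].
have clz : closure Om z by exact: subset_closure.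
have OXz : OX z by exact: clOm.
have [y [Yy vz _]] := attains_minP _ _ (qmin mu z mu0 OXz).
(* Testing [yb] in the regularized problem at [z] bounds its value above by [v x + e]. Testing [y]
   in the problem at [x] bounds it below by [v x - e], as the quadratic term at [y] is
   nonnegative. *)
have := min_value_le _ _ _ (qmin mu z mu0 OXz) Yyb.
have := min_value_le _ _ _ (gmin x OXx) Yy.
have := gmu (z, yb) (conj clz Yyb); have := gmu (z, y) (conj clz Yy).
have := gC z x yb; have := gC z x y.
have : 0 <= mu / 2 * enorm y ^+ 2 by rewrite mulr_ge0 ?sqr_ge0// divr_ge0// ltW.
rewrite -vz -vx /quad_reg /= !ler_norml !ltr_norml.
move=> ? /andP[? ?] /andP[? ?] /andP[? ?] /andP[? ?].
by move=> ? ?; apply/andP; split; lra.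
Unshelve. all: by end_near. Qed.
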